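(* The function $$\phi(x)=\psi(x)+\ln\bigl(e^{1/x}-1\bigr)$$ is both strictly increasing and strictly concave on $(0,\infty)$, and $$\lim_{x\to0^+}\phi(x)=-\gamma\quad\text{and}\quad \lim_{x\to\infty}\phi(x)=0.$$
   Context: $\Gamma$ is Euler's gamma function, $\psi(x)=\Gamma'(x)/\Gamma(x)$ is the psi (digamma) function, and $\gamma=0.577\ldots$ is the Euler–Mascheroni constant. *)

(* Defs.v *)
From Stdlib Require Import Reals.
From Coquelicot Require Import Coquelicot.
Open Scope R_scope.

(** Euler's integral, improper at both ends; meaningful for [0 < x]. *)
Definition Gamma (x : R) : R :=
  RInt_gen (fun t => Rpower t (x - 1) * exp (- t))
           (at_right 0) (Rbar_locally p_infty).

Definition psi (x : R) : R := Derive Gamma x / Gamma x.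

(** The index is shifted to start at 1: the [n]-th term is
    [1 + 1/2 + ... + 1/(n+1) - ln (n+1)]. *)
Definition Euler_gamma : R :=
  real (Lim_seq (fun n => sum_n (fun k => / INR (S k)) n - ln (INR (S n)))).

Definition phi (x : R) : R := psi x + ln (exp (1 / x) - 1).

Definition strictly_increasing_on (D : R -> Prop) (f : R -> R) : Prop :=
  forall x y : R, D x -> D y -> x < y -> f x < f y.

Definition strictly_concave_on (D : R -> Prop) (f : R -> R) : Prop :=
  forall x y t : R, D x -> D y -> x <> y -> 0 < t < 1 ->
    t * f x + (1 - t) * f y < f (t * x + (1 - t) * y).

(* Main.v *)
Require Import Defs.
From Stdlib Require Import Reals Lra.
From Coquelicot Require Import Coquelicot.
Open Scope R_scope.

(** Everything follows from the unit differences of [phi].  By the recurrence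
    [psi (x + 1) = psi x + / x], the difference [phi x - phi (x + 1)] is the
    elementary function [log_gap x = g x - / x - g (x + 1)], where
    [g x = ln (exp (1 / x) - 1)] is [log_term].

    Concavity: [log_gap] is strictly concave, since its second derivative reduces,
    with [u = / x] and [v = / (x + 1) = u / (1 + u)], to a comparison of explicit
    expressions in [u / (exp u - 1)] and [v / (exp v - 1)] ([curvature_gap]).
    As [phi] tends to [0] at infinity, [phi x] is the sum of [log_gap (x + k)]
    over [k], and it inherits strict concavity
    ([strictly_concave_of_telescoping]).

    Monotonicity: a strictly concave function with a finite limit at infinity
    is strictly increasing ([strictly_increasing_of_concave_limit]).

    Limit at infinity: [ln x - / x <= psi x <= ln x] ([ln_le_psi], [psi_le_ln]),
    and [0 <= g x + ln x <= / x] ([log_term_bounds]), so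
    [- / x <= phi x <= / x].

    Limit at [0]: in [phi x = log_gap x + phi (x + 1)] the right-hand side tends
    to [- g 1 + phi 1 = psi 1], and the bounds on [psi] with the recurrence
    give [psi 1 = - Euler_gamma] ([psi_one]).

    Four facts about Euler's integral are used: it converges, it is
    differentiable under the integral sign ([Gamma_derive]), it satisfies
    [Gamma (x + 1) = x Gamma x], and it is positive.  The bounds on [psi] then
    come from integrating tangent-line bounds for [ln] against the kernel. *)

(** * Concavity on the half-line *)

Lemma decreasing_of_neg_derive (f df : R -> R) :
  (forall x, 0 < x -> is_derive f x (df x)) ->
  (forall x, 0 < x -> df x < 0) ->
  forall x y, 0 < x -> x < y -> f y < f x.
Proof.
intros Hf Hneg x y Hx Hxy.
destruct (MVT_cor2 f df x y Hxy) as [c [E Hc]].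
- intros z Hz; apply is_derive_Reals, Hf; lra.
- assert (H := Hneg c ltac:(lra)). nra.
Qed.

Lemma strictly_concave_of_decreasing_derive (f df : R -> R) :
  (forall x, 0 < x -> is_derive f x (df x)) ->
  (forall x y, 0 < x -> x < y -> df y < df x) ->
  strictly_concave_on (fun x => 0 < x) f.
Proof.
intros Hf Hdec.
assert (mvt : forall x y, 0 < x -> x < y ->
  exists c, x < c < y /\ f y - f x = df c * (y - x)).
{ intros x y Hx Hxy.
  destruct (MVT_cor2 f df x y Hxy) as [c [E Hc]].
  - intros z Hz; apply is_derive_Reals, Hf; lra.
  - exists c; split; auto. }
assert (main : forall x y t, 0 < x -> x < y -> 0 < t < 1 ->
  t * f x + (1 - t) * f y < f (t * x + (1 - t) * y)).
{ intros x y t Hx Hxy Ht.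
  set (z := t * x + (1 - t) * y).
  assert (Ez1 : z - x = (1 - t) * (y - x)) by (unfold z; ring).
  assert (Ez2 : y - z = t * (y - x)) by (unfold z; ring).
  assert (P1 : 0 < (1 - t) * (y - x)) by (apply Rmult_lt_0_compat; lra).
  assert (P2 : 0 < t * (y - x)) by (apply Rmult_lt_0_compat; lra).
  destruct (mvt x z Hx ltac:(lra)) as [c [Hc Ec]].
  destruct (mvt z y ltac:(lra) ltac:(lra)) as [d [Hd Ed]].
  assert (Hcd := Hdec c d ltac:(lra) ltac:(lra)).
  rewrite Ez1 in Ec; rewrite Ez2 in Ed.
  assert (P : 0 < (1 - t) * (t * (y - x)) * (df c - df d))
    by (apply Rmult_lt_0_compat; [apply Rmult_lt_0_compat|]; lra).
  assert (E : f z - (t * f x + (1 - t) * f y) =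
              t * (f z - f x) - (1 - t) * (f y - f z)) by ring.
  rewrite Ec, Ed in E.
  assert (E' : f z - (t * f x + (1 - t) * f y) =
     (1 - t) * (t * (y - x)) * (df c - df d)) by (rewrite E; ring).
  lra. }
intros x y t Hx Hy Hxy Ht.
destruct (Rtotal_order x y) as [H|[H|H]]; [|contradiction|].
- apply main; auto.
- assert (M := main y x (1 - t) Hy H ltac:(lra)).
  replace (1 - (1 - t)) with t in M by ring.
  rewrite (Rplus_comm (t * x)), (Rplus_comm (t * f x)); exact M.
Qed.

(** Since [f x] is formally the sum of [d (x + k)] over [k], concavity passes
    from [d] to [f].  No series is needed: the concavity excess of [f] at the
    points shifted by [n] decreases strictly in [n] and tends to [0]. *)
Lemma strictly_concave_of_telescoping (f d : R -> R) :
  strictly_concave_on (fun x => 0 < x) d ->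
  (forall x, 0 < x -> f x = d x + f (x + 1)) ->
  (forall x, is_lim_seq (fun n => f (x + INR n)) 0) ->
  strictly_concave_on (fun x => 0 < x) f.
Proof.
intros Hd Hstep Hlim x y t Hx Hy Hxy Ht.
set (z := t * x + (1 - t) * y).
set (excess := fun s => f (z + s) - (t * f (x + s) + (1 - t) * f (y + s))).
assert (Hz : 0 < z) by (unfold z; nra).
assert (drop : forall s, 0 <= s -> excess (s + 1) < excess s).
{ intros s Hs; unfold excess.
  rewrite (Hstep (z + s)), (Hstep (x + s)), (Hstep (y + s)) by lra.
  rewrite <- !Rplus_assoc.
  assert (C := Hd (x + s) (y + s) t ltac:(lra) ltac:(lra) ltac:(lra) Ht).
  replace (t * (x + s) + (1 - t) * (y + s)) with (z + s) in C by (unfold z; ring).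
  lra. }
assert (mono : forall n, excess (INR (S n)) <= excess 1).
{ induction n as [|n IH]; [simpl; lra|].
  rewrite S_INR. assert (D := drop (INR (S n)) (pos_INR _)). lra. }
assert (lim : is_lim_seq (fun n => excess (INR n)) 0).
{ unfold excess; replace 0 with (0 - (t * 0 + (1 - t) * 0)) by ring.
  apply is_lim_seq_minus'; [apply Hlim|].
  apply is_lim_seq_plus'; apply (is_lim_seq_scal_l _ _ 0), Hlim. }
apply is_lim_seq_incr_1 in lim.
assert (nonneg : 0 <= excess 1)
  by exact (is_lim_seq_le _ _ 0 (excess 1) mono lim (is_lim_seq_const _)).
assert (first := drop 0 (Rle_refl 0)). rewrite Rplus_0_l in first.
unfold excess at 2 in first. rewrite !Rplus_0_r in first. lra.
Qed.

(** A concave function that decreases somewhere stays below a line of negative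
    slope from then on, so it tends to minus infinity. *)
Lemma strictly_increasing_of_concave_limit (f : R -> R) (l : R) :
  strictly_concave_on (fun x => 0 < x) f -> is_lim f p_infty l ->
  strictly_increasing_on (fun x => 0 < x) f.
Proof.
intros Hf Hl.
assert (chord : forall x y z, 0 < x -> x < y -> y < z ->
  (f z - f y) * (y - x) < (f y - f x) * (z - y)).
{ intros x y z Hx Hxy Hyz.
  set (t := (z - y) / (z - x)).
  assert (Et : t * (z - x) = z - y) by (unfold t; field; lra).
  assert (Ht : 0 < t < 1) by (split; nra).
  assert (C := Hf x z t Hx ltac:(lra) ltac:(lra) Ht).
  replace (t * x + (1 - t) * z) with y in C by lra.
  assert (C' := Rmult_lt_compat_r (z - x) _ _ ltac:(lra) C).
  replace ((t * f x + (1 - t) * f z) * (z - x)) with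
    ((t * (z - x)) * f x + (z - x - t * (z - x)) * f z) in C' by ring.
  rewrite Et in C'. lra. }
assert (nondec : forall x y, 0 < x -> x < y -> f x <= f y).
{ intros x y Hx Hxy.
  destruct (Rle_lt_dec (f x) (f y)) as [|H]; auto; exfalso.
  set (m := (f x - f y) / (y - x)).
  assert (Hm : 0 < m) by (apply Rdiv_lt_0_compat; lra).
  assert (L : is_lim (fun z => f y - m * (z - y)) p_infty m_infty).
  { apply is_lim_ext with (fun z => (f y + m * y) + - m * z); [intros; ring|].
    apply is_lim_plus with (Finite (f y + m * y)) m_infty.
    - apply is_lim_const.
    - evar_last; [apply is_lim_scal_l, is_lim_id|].
      apply is_Rbar_mult_unique, is_Rbar_mult_sym, is_Rbar_mult_p_infty_neg.
      simpl; lra.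
    - reflexivity. }
  assert (B : Rbar_le l m_infty).
  { apply (is_lim_le_loc f (fun z => f y - m * (z - y)) p_infty l m_infty);
      [|exact Hl|exact L].
    exists y; intros z Hz.
    assert (C := chord x y z Hx Hxy Hz).
    apply Rmult_le_reg_r with (y - x); [lra|].
    replace ((f y - m * (z - y)) * (y - x)) with
      (f y * (y - x) - (f x - f y) * (z - y)) by (unfold m; field; lra). lra. }
  exact B. }
intros x y Hx Hy Hxy.
assert (C := chord x y (y + 1) Hx Hxy ltac:(lra)).
assert (N := nondec y (y + 1) Hy ltac:(lra)). nra.
Qed.

(** * The elementary term and its unit difference *)

Lemma exp_gt_1 u : 0 < u -> 1 < exp u.
Proof. intros H; rewrite <- exp_0; apply exp_increasing, H. Qed.

(** The generating function of the Bernoulli numbers: with [u = / x], the first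
    two derivatives of [log_term] at [x] are polynomials in [u] and [bern u]. *)
Definition bern (u : R) : R := u / (exp u - 1).

Lemma bern_pos u : 0 < u -> 0 < bern u.
Proof.
intros H; assert (E := exp_gt_1 u H).
apply Rdiv_lt_0_compat; lra.
Qed.

(** Clearing denominators, the claim is [(2 - v) exp v <= 2 + v]; the two sides
    agree at [0] and the derivative of the difference has the sign of
    [(1 - v) - exp (- v)]. *)
Lemma bern_lower v : 0 < v -> v < 1 -> 1 - v / 2 <= bern v.
Proof.
intros Hv Hv1; assert (E := exp_gt_1 v Hv).
assert (D : (2 - v) * exp v - (2 + v) <= (2 - 0) * exp 0 - (2 + 0)).
{ destruct (MVT_cor2 (fun v => (2 - v) * exp v - (2 + v))
              (fun v => (1 - v) * exp v - 1) 0 v Hv) as [c [Ec Hc]].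
  - intros z Hz; apply is_derive_Reals; auto_derive; auto; ring.
  - assert (P : (1 - c) * exp c <= 1).
    { assert (X := exp_ineq1_le (- c)). rewrite exp_Ropp in X.
      assert (Y := exp_pos c).
      apply Rmult_le_reg_r with (/ exp c).
      - apply Rinv_0_lt_compat, Y.
      - rewrite Rmult_assoc, Rinv_r by lra. lra. }
    assert (0 <= (1 - (1 - c) * exp c) * (v - 0)) by (apply Rmult_le_pos; lra).
    simpl in Ec; lra. }
rewrite exp_0 in D.
unfold bern. apply Rmult_le_reg_r with (exp v - 1); [lra|].
unfold Rdiv at 2; rewrite Rmult_assoc, Rinv_l by lra. lra.
Qed.

(** Follows from [1 + v + v ^ 2 / 2 <= exp v], because
    [(v + v ^ 2 / 2) (1 - v / 2 + v ^ 2 / 2) = v (1 + v ^ 2 / 4 + v ^ 3 / 4)]. *)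
Lemma bern_upper v : 0 < v -> bern v <= 1 - v / 2 + v ^ 2 / 2.
Proof.
intros Hv; assert (E := exp_gt_1 v Hv).
assert (D : 1 + v + v ^ 2 / 2 <= exp v).
{ destruct (MVT_cor2 (fun v => (1 + v + v ^ 2 / 2) * exp (- v))
              (fun v => - (v ^ 2 / 2) * exp (- v)) 0 v Hv) as [c [Ec Hc]].
  - intros z Hz; apply is_derive_Reals; auto_derive; auto; field.
  - assert (0 <= (c ^ 2 / 2 * exp (- c)) * (v - 0)).
    { apply Rmult_le_pos; [apply Rmult_le_pos|lra]; [nra|].
      apply Rlt_le, exp_pos. }
    rewrite Ropp_0, exp_0, exp_Ropp in Ec.
    assert (X : (1 + v + v ^ 2 / 2) * / exp v <= 1) by lra.
    assert (Y := exp_pos v).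
    apply Rmult_le_compat_r with (r := exp v) in X; [|lra].
    rewrite Rmult_assoc, Rinv_l in X by lra. lra. }
unfold bern. apply Rmult_le_reg_r with (exp v - 1); [lra|].
unfold Rdiv at 1; rewrite Rmult_assoc, Rinv_l by lra.
assert (0 <= (1 - v / 2 + v ^ 2 / 2) * (exp v - (1 + v + v ^ 2 / 2)))
  by (apply Rmult_le_pos; nra).
assert (0 <= v ^ 3 * (1 + v)) by (apply Rmult_le_pos; [apply pow_le|]; lra).
nra.
Qed.

Definition log_term (x : R) : R := ln (exp (1 / x) - 1).

Lemma log_term_derive x : 0 < x ->
  is_derive log_term x (- (/ x * (bern (/ x) + / x))).
Proof.
intros Hx.
assert (E := exp_gt_1 (/ x) (Rinv_0_lt_compat _ Hx)).
unfold log_term, bern; auto_derive; replace (1 * / x) with (/ x) in * by ring.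
- lra.
- replace (1 / x) with (/ x) by (field; lra). field. lra.
Qed.

Lemma log_term_derive2 x : 0 < x ->
  is_derive (fun y => - (/ y * (bern (/ y) + / y))) x
    ((/ x) ^ 2 * ((bern (/ x) + / x) * (2 - bern (/ x)))).
Proof.
intros Hx.
assert (E := exp_gt_1 (/ x) (Rinv_0_lt_compat _ Hx)).
unfold bern; auto_derive.
- repeat split; lra.
- field. lra.
Qed.

(** With [u = / x] and [v = / (x + 1)] this says that the second derivative of
    [log_gap] at [x] is negative.  Completing squares, with [B] for [bern],
    turns the left side into
    [u ^ 2 ((1 - u / 2) ^ 2 - (B u - 1 + u / 2) ^ 2)] and the right side into
    [v ^ 2 ((1 + v / 2) ^ 2 - (B v - 1 + v / 2) ^ 2)].  On the left the
    subtracted square is dropped, on the right it is at most [v ^ 4 / 4], and a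
    polynomial inequality in [v] remains.  Dropping the square would be too
    lossy for [u >= 2], but there the left side equals
    [- u ^ 2 B u (u - 2 + B u)], which is negative. *)
Lemma curvature_gap u v : 0 < u -> v = u / (1 + u) ->
  u ^ 2 * ((bern u + u) * (2 - bern u)) - 2 * u ^ 3 <
  v ^ 2 * ((bern v + v) * (2 - bern v)).
Proof.
intros Hu Ev.
assert (Hv : 0 < v) by (rewrite Ev; apply Rdiv_lt_0_compat; lra).
assert (Hv1 : v < 1).
{ assert (v * (1 + u) = u) by (rewrite Ev; field; lra). nra. }
assert (Eu : u = v / (1 - v)).
{ rewrite Ev; field; lra. }
assert (L := bern_lower v Hv Hv1); assert (U := bern_upper v Hv).
set (d := bern v - 1 + v / 2).
assert (Hd : 0 <= d <= v ^ 2 / 2) by (unfold d; lra).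
assert (Hd2 : d ^ 2 <= v ^ 4 / 4) by nra.
replace ((bern v + v) * (2 - bern v)) with ((1 + v / 2) ^ 2 - d ^ 2)
  by (unfold d; field).
assert (Bu := bern_pos u Hu).
replace (u ^ 2 * ((bern u + u) * (2 - bern u)) - 2 * u ^ 3)
  with (u ^ 2 * ((1 - u / 2) ^ 2 - (bern u - 1 + u / 2) ^ 2)) by field.
assert (Hv2 : 0 < v ^ 2) by nra.
assert (Pv : 0 < v ^ 2 * ((1 + v / 2) ^ 2 - v ^ 4 / 4)).
{ apply Rmult_lt_0_compat; auto.
  replace ((1 + v / 2) ^ 2 - v ^ 4 / 4)
    with ((1 + v / 2 + v ^ 2 / 2) * (1 + v / 2 - v ^ 2 / 2)) by field.
  apply Rmult_lt_0_compat; nra. }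
apply Rlt_le_trans with (v ^ 2 * ((1 + v / 2) ^ 2 - v ^ 4 / 4));
  [|apply Rmult_le_compat_l; lra].
destruct (Rle_lt_dec 2 u) as [H2|H2].
- apply Rle_lt_trans with 0; auto.
  replace ((1 - u / 2) ^ 2 - (bern u - 1 + u / 2) ^ 2)
    with (- (bern u * (u - 2 + bern u))) by field.
  assert (0 <= bern u * (u - 2 + bern u)) by (apply Rmult_le_pos; lra).
  assert (0 <= u ^ 2) by nra. nra.
- apply Rle_lt_trans with (u ^ 2 * (1 - u / 2) ^ 2).
  { apply Rmult_le_compat_l; [nra|].
    assert (0 <= (bern u - 1 + u / 2) ^ 2) by apply pow2_ge_0. lra. }
  assert (Hv3 : v < 2 / 3).
  { assert (v * (1 + u) = u) by (rewrite Ev; field; lra).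
    apply Rmult_lt_reg_r with (1 + u); lra. }
  replace (u ^ 2 * (1 - u / 2) ^ 2) with
    (v ^ 2 * (1 - 3 * v / 2) ^ 2 / (1 - v) ^ 4)
    by (rewrite Eu; field; lra).
  assert (Hw : 0 < (1 - v) ^ 4) by (apply pow_lt; lra).
  apply Rmult_lt_reg_r with ((1 - v) ^ 4); auto.
  unfold Rdiv at 1. rewrite Rmult_assoc, Rinv_l by lra.
  (* The polynomial gap is [v ^ 5] times this bracket; near [v = 2 / 3] the
     margin comes from [v ^ 3 / 4]. *)
  assert (B : 0 < 1 - 3 * v / 2 + v ^ 3 / 4 - v * (1 - v) ^ 4 / 4).
  { destruct (Rle_lt_dec v (1 / 2)) as [H|H].
    - assert (H1 : (1 - v) ^ 4 <= 1 ^ 4) by (apply pow_incr; lra).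
      assert (0 < v ^ 3) by (apply pow_lt; lra). nra.
    - assert (H1 : (1 - v) ^ 4 <= (1 / 2) ^ 4) by (apply pow_incr; lra).
      assert (H5 : (1 / 2) ^ 2 <= v ^ 2) by (apply pow_incr; lra).
      assert (H3 : v * (1 / 2) ^ 2 <= v * v ^ 2)
        by (apply Rmult_le_compat_l; lra).
      assert (H4 : v * (1 - v) ^ 4 <= v * (1 / 2) ^ 4)
        by (apply Rmult_le_compat_l; lra).
      replace (v ^ 3) with (v * v ^ 2) by ring. lra. }
  assert (0 < v ^ 5 * (1 - 3 * v / 2 + v ^ 3 / 4 - v * (1 - v) ^ 4 / 4))
    by (apply Rmult_lt_0_compat; [apply pow_lt|]; lra).
  rewrite Rmult_1_r.
  apply Rlt_0_minus.
  replace (v ^ 2 * ((1 + v / 2) ^ 2 - v ^ 4 / 4) * (1 - v) ^ 4 -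
           v ^ 2 * (1 - 3 * v / 2) ^ 2)
    with (v ^ 5 * (1 - 3 * v / 2 + v ^ 3 / 4 - v * (1 - v) ^ 4 / 4)) by field.
  assumption.
Qed.

(** The difference [phi x - phi (x + 1)], with the digamma part already
    evaluated by its recurrence. *)
Definition log_gap (x : R) : R := log_term x - / x - log_term (x + 1).

Definition log_gap_slope (x : R) : R :=
  - (/ x * (bern (/ x) + / x)) + (/ x) ^ 2
  + / (x + 1) * (bern (/ (x + 1)) + / (x + 1)).

Lemma is_derive_shift (f : R -> R) (x l : R) :
  is_derive f (x + 1) l -> is_derive (fun y => f (y + 1)) x l.
Proof.
intros H.
replace l with (scal 1 l) by (unfold scal; simpl; unfold mult; simpl; ring).
apply (is_derive_comp f (fun y => y + 1)); auto.
auto_derive; auto.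
Qed.

Lemma log_gap_derive x : 0 < x -> is_derive log_gap x (log_gap_slope x).
Proof.
intros Hx.
replace (log_gap_slope x) with
  ((- (/ x * (bern (/ x) + / x)) - (- (/ x) ^ 2)) -
   (- (/ (x + 1) * (bern (/ (x + 1)) + / (x + 1)))))
  by (unfold log_gap_slope; ring).
apply (is_derive_minus (fun x => log_term x - / x)).
- apply (is_derive_minus log_term).
  + apply log_term_derive, Hx.
  + auto_derive; [lra|]. field. lra.
- apply is_derive_shift, log_term_derive; lra.
Qed.

Lemma log_gap_derive2 x : 0 < x ->
  is_derive log_gap_slope x
    ((/ x) ^ 2 * ((bern (/ x) + / x) * (2 - bern (/ x))) - 2 * (/ x) ^ 3
     - (/ (x + 1)) ^ 2 *
       ((bern (/ (x + 1)) + / (x + 1)) * (2 - bern (/ (x + 1))))).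
Proof.
intros Hx.
apply is_derive_ext with (fun y =>
  (- (/ y * (bern (/ y) + / y)) - (- (/ y) ^ 2)) -
  (- (/ (y + 1) * (bern (/ (y + 1)) + / (y + 1))))).
{ intros t; unfold log_gap_slope; simpl; ring. }
apply (is_derive_minus (fun y =>
  - (/ y * (bern (/ y) + / y)) - (- (/ y) ^ 2))).
- apply (is_derive_minus (fun y => - (/ y * (bern (/ y) + / y)))).
  + apply log_term_derive2, Hx.
  + auto_derive; [lra|]. field. lra.
- apply (is_derive_shift (fun y => - (/ y * (bern (/ y) + / y)))).
  apply log_term_derive2; lra.
Qed.

Lemma log_gap_concave : strictly_concave_on (fun x => 0 < x) log_gap.
Proof.
apply strictly_concave_of_decreasing_derive with log_gap_slope.
- exact log_gap_derive.
- intros x y Hx Hxy.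
  refine (decreasing_of_neg_derive _ _ log_gap_derive2 _ x y Hx Hxy).
  intros z Hz.
  assert (C := curvature_gap (/ z) (/ (z + 1)) (Rinv_0_lt_compat _ Hz)).
  assert (E : / (z + 1) = / z / (1 + / z)) by (field; lra).
  specialize (C E). lra.
Qed.

(** [log_term x + ln x] is [ln ((exp u - 1) / u)] for [u = / x], and
    [u <= exp u - 1 <= u exp u]. *)
Lemma log_term_bounds x : 0 < x -> 0 <= log_term x + ln x <= / x.
Proof.
intros Hx.
assert (Hu := Rinv_0_lt_compat _ Hx).
unfold log_term; replace (1 / x) with (/ x) by (field; lra).
assert (E := exp_gt_1 _ Hu).
rewrite <- ln_mult by lra.
assert (L : 1 <= (exp (/ x) - 1) * x).
{ assert (X := exp_ineq1_le (/ x)).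
  apply Rmult_le_reg_r with (/ x); auto.
  rewrite Rmult_assoc, Rinv_r by lra. lra. }
split.
- rewrite <- ln_1. apply ln_le; lra.
- rewrite <- (ln_exp (/ x)) at 2. apply ln_le; [lra|].
  assert (X := exp_ineq1_le (- / x)).
  assert (Y : exp (/ x) * exp (- / x) = 1)
    by (rewrite <- exp_plus, Rplus_opp_r; apply exp_0).
  assert (exp (/ x) * (1 + - / x) <= 1)
    by (rewrite <- Y; apply Rmult_le_compat_l; lra).
  apply Rmult_le_reg_r with (/ x); auto.
  rewrite Rmult_assoc, Rinv_r by lra. lra.
Qed.

(** * One-sided limits *)

Lemma ball_R (x y : R) (e : posreal) : ball x e y -> x - e < y < x + e.
Proof.
intros H; change (Rabs (y - x) < e) in H; apply Rabs_def2 in H; lra.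
Qed.

Lemma at_right_0_pos (P : R -> Prop) : (forall x, 0 < x -> P x) -> at_right 0 P.
Proof.
intros H; exists (mkposreal 1 Rlt_0_1); intros x _ Hx; apply H, Hx.
Qed.

Lemma continuous_at_right_0 (f : R -> R) :
  continuous f 0 -> filterlim f (at_right 0) (locally (f 0)).
Proof.
intros H P HP; destruct (H P HP) as [d Hd]; exists d; intros y Hy _; apply Hd, Hy.
Qed.

Lemma squeeze_at_right_0 (f g h : R -> R) (l : R) :
  (forall x, 0 < x -> f x <= g x <= h x) ->
  filterlim f (at_right 0) (locally l) -> filterlim h (at_right 0) (locally l) ->
  filterlim g (at_right 0) (locally l).
Proof.
intros H; apply (filterlim_le_le (F := at_right 0) f g h (Finite l)).
apply at_right_0_pos, H.
Qed.

Lemma continuous_of_derive (f : R -> R) (x : R) : ex_derive f x -> continuous f x.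
Proof. apply (@ex_derive_continuous R_AbsRing R_NormedModule). Qed.

Lemma exp_le a b : a <= b -> exp a <= exp b.
Proof.
intros [H|H]; [apply Rlt_le, exp_increasing, H|rewrite H; apply Rle_refl].
Qed.

Lemma exp_mul_ln_lim_0 x : 0 < x ->
  filterlim (fun t => exp (x * ln t)) (at_right 0) (locally 0).
Proof.
intros Hx; apply filterlim_locally; intros eps.
exists (mkposreal _ (exp_pos (ln eps / x))); intros t Ht Ht0.
apply ball_R in Ht; simpl in Ht.
change (Rabs (exp (x * ln t) - 0) < eps).
rewrite Rminus_0_r, Rabs_pos_eq by (apply Rlt_le, exp_pos).
rewrite <- (exp_ln eps) by apply cond_pos.
apply exp_increasing.
assert (L : ln t < ln eps / x)
  by (rewrite <- (ln_exp (ln eps / x)); apply ln_increasing; lra).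
apply Rmult_lt_compat_l with (r := x) in L; auto.
replace (x * (ln eps / x)) with (ln eps) in L by (field; lra). exact L.
Qed.

Lemma is_lim_inv_p_infty : is_lim Rinv p_infty 0.
Proof.
evar_last; [apply is_lim_inv; [apply is_lim_id|discriminate]|reflexivity].
Qed.

(** * Improper integrals over the half-line *)

Definition is_half_line_integral (f : R -> R) (l : R) : Prop :=
  is_RInt_gen f (at_right 0) (Rbar_locally p_infty) l.

(** To check a property eventually along the filter of the improper integral, it
    is enough to check it for all compact subintervals of the open half-line. *)
Lemma half_line_prod (P : R * R -> Prop) :
  (forall a b, 0 < a -> a <= b -> P (a, b)) ->
  filter_prod (at_right 0) (Rbar_locally p_infty) P.
Proof.
intros H.
apply Filter_prod with (fun a => 0 < a < 1) (fun b => 1 < b).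
- exists (mkposreal 1 Rlt_0_1); intros y Hy Hy0.
  apply ball_R in Hy; simpl in Hy; lra.
- exists 1; auto.
- intros a b Ha Hb; apply H; lra.
Qed.

Lemma half_line_ext (f g : R -> R) (l : R) :
  (forall t, 0 < t -> f t = g t) ->
  is_half_line_integral f l -> is_half_line_integral g l.
Proof.
intros E.
apply (@is_RInt_gen_ext R_NormedModule (at_right 0) (Rbar_locally p_infty) _ _ f g).
apply half_line_prod; simpl; intros a b Ha Hab t.
rewrite Rmin_left, Rmax_right by lra; intros Ht; apply E; lra.
Qed.

Lemma half_line_abs_le (f g : R -> R) (lf lg : R) :
  (forall t, 0 < t -> Rabs (f t) <= g t) ->
  is_half_line_integral f lf -> is_half_line_integral g lg -> Rabs lf <= lg.
Proof.
intros H; apply (@RInt_gen_norm R_CompleteNormedModule _ _ _ _ f g lf lg);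
  apply half_line_prod; simpl; intros a b Ha Hab; auto.
intros x Hx; apply H; lra.
Qed.

Lemma half_line_plus f g lf lg :
  is_half_line_integral f lf -> is_half_line_integral g lg ->
  is_half_line_integral (fun t => f t + g t) (lf + lg).
Proof.
apply (@is_RInt_gen_plus R_NormedModule _ _ _ _ f g lf lg).
Qed.

Lemma half_line_minus f g lf lg :
  is_half_line_integral f lf -> is_half_line_integral g lg ->
  is_half_line_integral (fun t => f t - g t) (lf - lg).
Proof.
apply (@is_RInt_gen_minus R_NormedModule _ _ _ _ f g lf lg).
Qed.

Lemma half_line_scal f k l :
  is_half_line_integral f l -> is_half_line_integral (fun t => k * f t) (k * l).
Proof.
apply (@is_RInt_gen_scal R_NormedModule _ _ _ _ f k l).
Qed.

Lemma half_line_le (f g : R -> R) (lf lg : R) :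
  (forall t, 0 < t -> f t <= g t) ->
  is_half_line_integral f lf -> is_half_line_integral g lg -> lf <= lg.
Proof.
intros H Hf Hg.
(* Comparing [g - f] with itself in the triangle inequality gives
   [Rabs (lg - lf) <= lg - lf], hence the sign. *)
assert (D := half_line_minus _ _ _ _ Hg Hf).
assert (A : Rabs (lg - lf) <= lg - lf).
{ refine (half_line_abs_le _ _ _ _ _ D D).
  intros t Ht; rewrite Rabs_pos_eq; specialize (H t Ht); lra. }
assert (P := Rabs_pos (lg - lf)); lra.
Qed.

Lemma half_line_unique f l l' :
  is_half_line_integral f l -> is_half_line_integral f l' -> l = l'.
Proof.
intros H H'; apply Rle_antisym;
  (eapply half_line_le; [|eassumption|eassumption]); intros; apply Rle_refl.
Qed.

Lemma half_line_antiderivative (F f : R -> R) (l0 l1 : R) :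
  (forall t, 0 < t -> is_derive F t (f t)) ->
  (forall t, 0 < t -> continuous f t) ->
  filterlim F (at_right 0) (locally l0) -> is_lim F p_infty l1 ->
  is_half_line_integral f (l1 - l0).
Proof.
intros HF Hf H0 H1.
apply half_line_ext with (Derive F).
{ intros t Ht; apply is_derive_unique, HF, Ht. }
apply (@is_RInt_gen_Derive (at_right 0) (Rbar_locally p_infty) _ _ F l0 l1);
  [| |exact H0|exact H1]; apply half_line_prod; simpl;
  intros a b Ha Hab t; rewrite Rmin_left, Rmax_right by lra; intros Ht.
- exists (f t); apply HF; lra.
- apply continuous_ext_loc with f.
  + exists (mkposreal t ltac:(lra)); intros y Hy.
    apply ball_R in Hy; simpl in Hy. symmetry; apply is_derive_unique, HF; lra.
  + apply Hf; lra.
Qed.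

(** The integral over [[a, b]] is a Cauchy net as [a] tends to [0] and [b] to
    infinity: moving an endpoint changes the integral of [f] by at most as much
    as that of [g], which converges. *)
Lemma half_line_dominated (f g : R -> R) (lg : R) :
  (forall t, 0 < t -> continuous f t) -> (forall t, 0 < t -> continuous g t) ->
  (forall t, 0 < t -> Rabs (f t) <= g t) ->
  is_half_line_integral g lg -> exists l, is_half_line_integral f l.
Proof.
intros Cf Cg H Hg.
assert (ex : forall h, (forall t, 0 < t -> continuous h t) ->
  forall a b, 0 < a -> 0 < b -> ex_RInt (V := R_CompleteNormedModule) h a b).
{ intros h Ch a b Ha Hb; apply ex_RInt_continuous; intros z Hz; apply Ch.
  apply Rlt_le_trans with (2 := proj1 Hz), Rmin_glb_lt; lra. }
assert (bnd : forall a b, 0 < a -> 0 < b ->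
  Rabs (RInt f a b) <= Rabs (RInt g a b)).
{ assert (W : forall a b, 0 < a -> a <= b -> Rabs (RInt f a b) <= Rabs (RInt g a b)).
  { intros a b Ha Hab. apply Rle_trans with (RInt g a b); [|apply Rle_abs].
    apply (@norm_RInt_le R_CompleteNormedModule f g a b); auto.
    - intros; apply H; lra.
    - apply (@RInt_correct R_CompleteNormedModule), ex; auto; lra.
    - apply (@RInt_correct R_CompleteNormedModule), ex; auto; lra. }
  intros a b Ha Hb; destruct (Rle_lt_dec a b); [apply W; auto|].
  rewrite <- (opp_RInt_swap f), <- (opp_RInt_swap g) by (apply ex; auto).
  unfold opp; simpl; rewrite !Rabs_Ropp; apply W; lra. }
assert (chasles : forall h, (forall t, 0 < t -> continuous h t) ->
  forall a b c, 0 < a -> 0 < b -> 0 < c -> RInt h a b + RInt h b c = RInt h a c).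
{ intros h Ch a b c Ha Hb Hc;
  apply (@RInt_Chasles R_CompleteNormedModule); apply ex; auto. }
assert (Lg : filterlim (fun ab => RInt g (fst ab) (snd ab))
  (filter_prod (at_right 0) (Rbar_locally p_infty)) (locally lg)).
{ intros P HP; specialize (Hg P HP); unfold filtermapi in Hg; unfold filtermap.
  revert Hg; apply filter_imp; intros [a b] [y [Hy Py]]; simpl in *.
  rewrite (is_RInt_unique _ _ _ _ Hy); exact Py. }
assert (Lf : exists y : R, filterlim (fun ab => RInt f (fst ab) (snd ab))
  (filter_prod (at_right 0) (Rbar_locally p_infty)) (locally y)).
{ apply (proj1 (filterlim_locally_cauchy (U := R_CompleteSpace)
    (fun ab => RInt f (fst ab) (snd ab)))); intros eps.
  destruct (proj2 (filterlim_locally_cauchy (U := R_CompleteSpace) _) (ex_intro _ lg Lg)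
              (pos_div_2 eps)) as [P [HP HPb]].
  assert (HP' := filter_and _ _ HP (half_line_prod
     (fun ab => 0 < fst ab /\ 0 < snd ab)
     (fun a b Ha Hb => conj Ha (Rlt_le_trans _ _ _ Ha Hb)))).
  destruct HP' as [Q1 Q2 HQ1 HQ2 HQ].
  exists (fun ab => Q1 (fst ab) /\ Q2 (snd ab)); split.
  - exists Q1 Q2; auto.
  - intros [a b] [a' b'] [Ha Hb] [Ha' Hb']; simpl in *.
    destruct (HQ a b Ha Hb) as [P1 [p1 p2]].
    destruct (HQ a' b' Ha' Hb') as [P2 [p3 p4]].
    destruct (HQ a' b Ha' Hb) as [P3 _]. simpl in *.
    assert (B1 := HPb _ _ P1 P3). assert (B2 := HPb _ _ P3 P2).
    unfold ball in *; simpl in *; unfold AbsRing_ball, abs, minus, plus, opp in *;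
    simpl in *.
    assert (E1 := chasles g Cg a' a b p3 p1 p2).
    assert (E2 := chasles g Cg a' b b' p3 p2 p4).
    assert (E3 := chasles f Cf a' a b p3 p1 p2).
    assert (E4 := chasles f Cf a' b b' p3 p2 p4).
    replace (RInt g a' b + - RInt g a b) with (RInt g a' a) in B1 by lra.
    replace (RInt g a' b' + - RInt g a' b) with (RInt g b b') in B2 by lra.
    replace (RInt f a' b' + - RInt f a b) with (RInt f a' a + RInt f b b') by lra.
    assert (T := Rabs_triang (RInt f a' a) (RInt f b b')).
    assert (b1 := bnd a' a p3 p1). assert (b2 := bnd b b' p2 p4). lra. }
destruct Lf as [y Ly]; exists y.
intros P HP; specialize (Ly P HP); unfold filtermapi; unfold filtermap in Ly.
generalize (filter_and _ _ Ly (half_line_prod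
     (fun ab => 0 < fst ab /\ 0 < snd ab)
     (fun a b Ha Hb => conj Ha (Rlt_le_trans _ _ _ Ha Hb)))).
apply filter_imp; intros [a b] [Py [Ha Hb]]; simpl in *.
exists (RInt f a b); split; auto.
apply (@RInt_correct R_CompleteNormedModule), ex; auto.
Qed.

(** * The Gamma function *)

(** The integrand is [t ^ (x - 1) / (1 + t) ^ (x + 1)], with the antiderivative
    [(t / (1 + t)) ^ x / x].  It has the singularity of Euler's kernel at [0]
    and is integrable at infinity, so a multiple of it dominates Euler's kernel
    on the whole half-line at once. *)
Lemma beta_kernel_integral x : 0 < x ->
  is_half_line_integral
    (fun t => exp (x * (ln t - ln (1 + t))) / (t * (1 + t))) (/ x).
Proof.
intros Hx.
replace (/ x) with (/ x * 1 - / x * 0) by ring.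
apply half_line_antiderivative with (fun t => / x * exp (x * (ln t - ln (1 + t)))).
- intros t Ht; auto_derive; [repeat split; lra|].
  unfold Rminus; field; lra.
- intros t Ht. apply continuous_of_derive.
  auto_derive. repeat split; try lra. apply Rgt_not_eq; nra.
- apply (filterlim_comp _ _ _ (fun t => exp (x * (ln t - ln (1 + t))))
     (fun y => / x * y) _ (locally 0)).
  2: apply (@filterlim_scal_r R_AbsRing R_NormedModule (/ x) 0).
  apply squeeze_at_right_0 with (fun _ => 0) (fun t => exp (x * ln t)).
  + intros t Ht; split.
    * apply Rlt_le, exp_pos.
    * assert (0 < ln (1 + t)) by (rewrite <- ln_1; apply ln_increasing; lra).
      apply exp_le; nra.
  + apply filterlim_const.
  + apply exp_mul_ln_lim_0, Hx.
- apply (is_lim_scal_l _ (/ x) p_infty 1).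
  apply is_lim_le_le_loc with (fun t => 1 - x * / t) (fun _ => 1).
  + exists 0; intros t Ht.
    assert (L : - / t <= ln t - ln (1 + t) <= 0).
    { split.
      - assert (I := Rinv_0_lt_compat t Ht).
        replace (ln (1 + t)) with (ln t + ln (1 + / t)).
        2: { rewrite <- ln_mult by lra. f_equal; field; lra. }
        assert (ln (1 + / t) <= / t).
        { rewrite <- (ln_exp (/ t)) at 2; apply ln_le; [lra|apply exp_ineq1_le]. }
        lra.
      - assert (ln t <= ln (1 + t)) by (apply ln_le; lra). lra. }
    split.
    * assert (X := exp_ineq1_le (x * (ln t - ln (1 + t)))). nra.
    * apply Rle_trans with (exp 0); [|rewrite exp_0; lra].
      apply exp_le; nra.
  + evar_last.
    * apply is_lim_minus'.
      { apply is_lim_const. }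
      apply (is_lim_scal_l (fun t => / t) x p_infty 0).
      apply is_lim_inv_p_infty.
    * simpl. f_equal; ring.
  + apply is_lim_const.
Qed.

Definition euler_kernel (x t : R) : R := Rpower t (x - 1) * exp (- t).

Lemma euler_kernel_pos x t : 0 < euler_kernel x t.
Proof. apply Rmult_lt_0_compat; apply exp_pos. Qed.

Lemma euler_kernel_exp x t : euler_kernel x t = exp ((x - 1) * ln t - t).
Proof. unfold euler_kernel, Rpower; rewrite <- exp_plus; reflexivity. Qed.

Lemma euler_kernel_shift x h t :
  euler_kernel (x + h) t = exp (h * ln t) * euler_kernel x t.
Proof. rewrite !euler_kernel_exp, <- exp_plus; f_equal; ring. Qed.

Lemma euler_kernel_continuous x t : 0 < t -> continuous (euler_kernel x) t.
Proof.
intros Ht; apply continuous_of_derive.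
unfold euler_kernel, Rpower; auto_derive; auto.
Qed.

Lemma ln_le_tangent s t : 0 < s -> 0 < t -> ln t <= ln s + t / s - 1.
Proof.
intros Hs Ht.
assert (E : ln t - ln s = ln (t / s)) by (rewrite ln_div; auto).
assert (X := exp_ineq1_le (ln (t / s))).
rewrite exp_ln in X by (apply Rdiv_lt_0_compat; auto). lra.
Qed.

Lemma euler_kernel_le_beta x : 0 < x -> exists C, 0 < C /\ forall t, 0 < t ->
  euler_kernel x t <= C * (exp (x * (ln t - ln (1 + t))) / (t * (1 + t))).
Proof.
intros Hx.
exists (exp ((x + 1) * (ln (x + 1) - 1) + 1)); split; [apply exp_pos|].
intros t Ht.
replace (t * (1 + t)) with (exp (ln t + ln (1 + t)))
  by (rewrite exp_plus, !exp_ln; lra).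
unfold Rdiv; rewrite <- exp_Ropp, <- !exp_plus, euler_kernel_exp.
apply exp_le.
(* The tangent of [ln] at [x + 1] has slope [/ (x + 1)], so it bounds
   [(x + 1) * ln (1 + t)] by [t] plus a constant; this fixes [C]. *)
assert (L := ln_le_tangent (x + 1) (1 + t) ltac:(lra) ltac:(lra)).
assert (M : (x + 1) * ln (1 + t) <= (x + 1) * (ln (x + 1) - 1) + (1 + t)).
{ apply Rmult_le_compat_l with (r := x + 1) in L; [|lra].
  replace ((x + 1) * (ln (x + 1) + (1 + t) / (x + 1) - 1)) with
    ((x + 1) * (ln (x + 1) - 1) + (1 + t)) in L by (field; lra). exact L. }
lra.
Qed.

(** [Gamma] is defined by a total operator, so it carries its meaning only once
    the integral is known to converge; this follows from domination by the
    kernel of [beta_kernel_integral]. *)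
Lemma Gamma_integral x : 0 < x -> is_half_line_integral (euler_kernel x) (Gamma x).
Proof.
intros Hx.
destruct (euler_kernel_le_beta x Hx) as [C [HC H]].
destruct (half_line_dominated (euler_kernel x)
  (fun t => C * (exp (x * (ln t - ln (1 + t))) / (t * (1 + t))))
  (C * / x)) as [l Hl].
- apply euler_kernel_continuous.
- intros t Ht; apply continuous_of_derive.
  auto_derive. repeat split; try lra. apply Rgt_not_eq; nra.
- intros t Ht; rewrite Rabs_pos_eq; [apply H, Ht|apply Rlt_le, euler_kernel_pos].
- apply half_line_scal, beta_kernel_integral, Hx.
- unfold Gamma; fold (euler_kernel x).
  rewrite (is_RInt_gen_unique (euler_kernel x) l Hl). exact Hl.
Qed.

Lemma euler_boundary_0 x : 0 < x ->
  filterlim (fun t => exp (x * ln t - t)) (at_right 0) (locally 0).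
Proof.
intros Hx.
apply squeeze_at_right_0 with (fun _ => 0) (fun t => exp (x * ln t)).
- intros t Ht; split.
  + apply Rlt_le, exp_pos.
  + apply exp_le; lra.
- apply filterlim_const.
- apply exp_mul_ln_lim_0, Hx.
Qed.

Lemma euler_boundary_infty x : 0 < x ->
  is_lim (fun t => exp (x * ln t - t)) p_infty 0.
Proof.
intros Hx.
destruct (euler_kernel_le_beta x Hx) as [C [HC H]].
apply is_lim_le_le_loc with (fun _ => 0) (fun t => C * / t).
- exists 0; intros t Ht; split; [apply Rlt_le, exp_pos|].
  replace (x * ln t - t) with (ln t + ((x - 1) * ln t - t)) by ring.
  rewrite exp_plus, exp_ln, <- euler_kernel_exp by auto.
  apply Rle_trans with (t * (C * (exp 0 / (t * (1 + t))))).
  + apply Rmult_le_compat_l; [lra|].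
    eapply Rle_trans; [apply H, Ht|].
    apply Rmult_le_compat_l; [lra|].
    apply Rmult_le_compat_r; [apply Rlt_le, Rinv_0_lt_compat; nra|].
    apply exp_le. assert (ln t <= ln (1 + t)) by (apply ln_le; lra). nra.
  + rewrite exp_0. replace (t * (C * (1 / (t * (1 + t))))) with (C * / (1 + t))
      by (field; lra).
    apply Rmult_le_compat_l; [lra|]. apply Rinv_le_contravar; lra.
- apply is_lim_const.
- evar_last; [apply is_lim_scal_l, is_lim_inv_p_infty|].
  simpl; f_equal; ring.
Qed.

(** Integration by parts: [x t ^ (x - 1) exp (- t) - t ^ x exp (- t)] is the
    derivative of [t ^ x exp (- t)], which vanishes at both ends. *)
Lemma Gamma_succ x : 0 < x -> Gamma (x + 1) = x * Gamma x.
Proof.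
intros Hx.
assert (B : is_half_line_integral
  (fun t => x * euler_kernel x t - euler_kernel (x + 1) t) (0 - 0)).
{ apply half_line_antiderivative with (fun t => exp (x * ln t - t)).
  - intros t Ht.
    rewrite euler_kernel_shift, Rmult_1_l, exp_ln, euler_kernel_exp by auto.
    replace ((x - 1) * ln t - t) with (x * ln t - t + - ln t) by ring.
    rewrite exp_plus, exp_Ropp, exp_ln by auto.
    auto_derive; auto. unfold Rminus; field; lra.
  - intros t Ht; apply (continuous_minus (fun t => x * euler_kernel x t)).
    + apply (continuous_scal_r x (euler_kernel x)), euler_kernel_continuous, Ht.
    + apply euler_kernel_continuous, Ht.
  - apply euler_boundary_0, Hx.
  - apply euler_boundary_infty, Hx. }
assert (E := half_line_unique _ _ _ B
  (half_line_minus _ _ _ _ (half_line_scal _ x _ (Gamma_integral x Hx))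
     (Gamma_integral (x + 1) ltac:(lra)))).
lra.
Qed.

Lemma Rabs_le_exp_sum u : Rabs u <= exp u + exp (- u).
Proof.
assert (A := exp_ineq1_le u). assert (B := exp_ineq1_le (- u)).
assert (C := exp_pos u). assert (D := exp_pos (- u)).
apply Rabs_le; lra.
Qed.

(** From [exp (- u) >= 1 - u] one gets [exp u - 1 <= u exp u], so the remainder is
    at most [u (exp u - 1)].  The symmetric factor [exp u + exp (- u)] covers both
    signs of [u]. *)
Lemma exp_remainder u :
  0 <= exp u - 1 - u <= u ^ 2 * (exp u + exp (- u)).
Proof.
assert (A := exp_ineq1_le u). assert (B := exp_ineq1_le (- u)).
assert (C := exp_pos u). assert (D := exp_pos (- u)).
assert (E : exp u * exp (- u) = 1)
  by (rewrite <- exp_plus, Rplus_opp_r; apply exp_0).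
assert (F : exp u * (1 + - u) <= 1)
  by (rewrite <- E; apply Rmult_le_compat_l; lra).
split; [lra|].
apply Rle_trans with (u * (exp u - 1)); [lra|].
assert (0 <= u ^ 2) by apply pow2_ge_0.
destruct (Rle_lt_dec 0 u).
- apply Rle_trans with (u * (u * exp u)).
  + apply Rmult_le_compat_l; lra.
  + nra.
- assert (1 <= exp (- u)) by lra.
  apply Rle_trans with (u ^ 2); nra.
Qed.

Lemma sqr_le_exp_sum w : w ^ 2 <= 4 * (exp w + exp (- w)).
Proof.
assert (W : forall w, 0 <= w -> w ^ 2 <= 4 * exp w).
{ intros z Hz; assert (A := exp_ineq1_le (z / 2)).
  replace (exp z) with (exp (z / 2) * exp (z / 2))
    by (rewrite <- exp_plus; f_equal; field). nra. }
assert (C := exp_pos w). assert (D := exp_pos (- w)).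
destruct (Rle_lt_dec 0 w) as [H|H].
- specialize (W w H); lra.
- specialize (W (- w) ltac:(lra)). nra.
Qed.

Lemma exp_abs_le w u : Rabs u <= Rabs w -> exp u + exp (- u) <= 2 * (exp w + exp (- w)).
Proof.
intros H.
assert (X : forall v, v <= Rabs w -> exp v <= exp w + exp (- w)).
{ intros v Hv; assert (C := exp_pos w). assert (D := exp_pos (- w)).
  assert (E := exp_le _ _ Hv).
  unfold Rabs in E; destruct (Rcase_abs w); lra. }
assert (A := Rle_abs u). assert (B := Rle_abs (- u)). rewrite Rabs_Ropp in B.
assert (E1 := X u ltac:(lra)). assert (E2 := X (- u) ltac:(lra)). lra.
Qed.

(** With [w = (x / 2) ln t], the bound [Rabs w <= exp w + exp (- w)] dominates
    the integrand by Euler's kernels with parameters [3 x / 2] and [x / 2]. *)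
Lemma Gamma_derivative_integral x : 0 < x ->
  exists l, is_half_line_integral (fun t => ln t * euler_kernel x t) l.
Proof.
intros Hx.
apply half_line_dominated with
  (fun t => / (x / 2) * (euler_kernel (x + x / 2) t + euler_kernel (x + - (x / 2)) t))
  (/ (x / 2) * (Gamma (x + x / 2) + Gamma (x + - (x / 2)))).
- intros t Ht; apply continuous_of_derive.
  unfold euler_kernel, Rpower; auto_derive; auto.
- intros t Ht; apply continuous_of_derive.
  unfold euler_kernel, Rpower; auto_derive; auto.
- intros t Ht. assert (K := euler_kernel_pos x t).
  rewrite Rabs_mult, (Rabs_pos_eq (euler_kernel x t)) by lra.
  rewrite !euler_kernel_shift.
  assert (A := Rabs_le_exp_sum (x / 2 * ln t)).
  rewrite Rabs_mult, (Rabs_pos_eq (x / 2)) in A by lra.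
  replace (- (x / 2 * ln t)) with (- (x / 2) * ln t) in A by ring.
  rewrite <- Rmult_plus_distr_r, <- Rmult_assoc.
  apply Rmult_le_compat_r; [lra|].
  apply Rmult_le_reg_l with (x / 2); [lra|].
  rewrite <- Rmult_assoc, Rinv_r by lra. lra.
- apply half_line_scal, half_line_plus; apply Gamma_integral; lra.
Qed.

Lemma is_derive_of_quadratic (f : R -> R) (x l a M : R) : 0 < a ->
  (forall h, Rabs h <= a -> Rabs (f (x + h) - f x - h * l) <= h ^ 2 * M) ->
  is_derive f x l.
Proof.
intros Ha H; apply is_derive_Reals; intros eps Heps.
assert (HM : 0 < 1 + Rabs M) by (assert (P := Rabs_pos M); lra).
assert (Hd : 0 < Rmin a (eps / (1 + Rabs M)))
  by (apply Rmin_glb_lt; auto; apply Rdiv_lt_0_compat; auto).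
exists (mkposreal _ Hd); intros h Hh Hhd; simpl in Hhd.
assert (L1 := Rmin_l a (eps / (1 + Rabs M))).
assert (L2 := Rmin_r a (eps / (1 + Rabs M))).
assert (P := Rabs_pos_lt h Hh).
replace ((f (x + h) - f x) / h - l) with ((f (x + h) - f x - h * l) / h)
  by (field; auto).
unfold Rdiv; rewrite Rabs_mult, Rabs_inv.
apply Rmult_lt_reg_r with (Rabs h); auto.
rewrite Rmult_assoc, Rinv_l, Rmult_1_r by lra.
apply Rle_lt_trans with (1 := H h ltac:(lra)).
replace (h ^ 2) with (Rabs h * Rabs h) by (rewrite <- Rabs_mult, Rabs_pos_eq; nra).
assert (Q : Rabs h * (1 + Rabs M) < eps).
{ apply Rmult_lt_reg_r with (/ (1 + Rabs M)); [apply Rinv_0_lt_compat; auto|].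
  rewrite Rmult_assoc, Rinv_r by lra. unfold Rdiv in *; lra. }
assert (Z := Rle_abs M). nra.
Qed.

(** Differentiation under the integral sign.  With [u = h ln t] the kernel at
    [x + h] differs from its first-order expansion by
    [(exp u - 1 - u) t ^ (x - 1) exp (- t)].  For [Rabs h <= a = x / 4] this is at
    most [h ^ 2] times a fixed combination of the kernels at [x] and
    [x +- 2 a], which are integrable, so the error is [O (h ^ 2)]. *)
Lemma Gamma_derive x l : 0 < x ->
  is_half_line_integral (fun t => ln t * euler_kernel x t) l ->
  is_derive Gamma x l.
Proof.
intros Hx Hl.
set (a := x / 4). assert (Ha : 0 < a) by (unfold a; lra).
set (M := 8 / a ^ 2 * (Gamma (x + 2 * a) + 2 * Gamma x + Gamma (x + - (2 * a)))).
assert (I : is_half_line_integral (fun t => 8 / a ^ 2 *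
  (euler_kernel (x + 2 * a) t + 2 * euler_kernel x t
   + euler_kernel (x + - (2 * a)) t)) M).
{ apply half_line_scal, half_line_plus; [apply half_line_plus|].
  - apply Gamma_integral; lra.
  - apply (half_line_scal (euler_kernel x) 2), Gamma_integral, Hx.
  - apply Gamma_integral; unfold a; lra. }
apply is_derive_of_quadratic with a M; auto.
intros h Hh.
assert (Hxh : 0 < x + h).
{ unfold a in Hh; assert (Z := Rle_abs (- h)); rewrite Rabs_Ropp in Z; lra. }
refine (half_line_abs_le _ _ _ _ _
  (half_line_minus _ _ _ _
    (half_line_minus _ _ _ _ (Gamma_integral (x + h) Hxh) (Gamma_integral x Hx))
    (half_line_scal _ h _ Hl))
  (half_line_scal _ (h ^ 2) _ I)).
intros t Ht.
rewrite !euler_kernel_shift.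
assert (K := euler_kernel_pos x t).
set (k := euler_kernel x t) in *.
set (u := h * ln t). set (w := a * ln t).
replace (exp u * k - k - h * (ln t * k)) with ((exp u - 1 - u) * k)
  by (unfold u; ring).
replace (exp (2 * a * ln t)) with (exp w * exp w)
  by (rewrite <- exp_plus; f_equal; unfold w; ring).
replace (exp (- (2 * a) * ln t)) with (exp (- w) * exp (- w))
  by (rewrite <- exp_plus; f_equal; unfold w; ring).
assert (E : exp w * exp (- w) = 1)
  by (rewrite <- exp_plus, Rplus_opp_r; apply exp_0).
assert (R := exp_remainder u).
rewrite Rabs_pos_eq by (apply Rmult_le_pos; lra).
assert (U := exp_abs_le w u).
assert (Huw : Rabs u <= Rabs w).
{ unfold u, w; rewrite !Rabs_mult, (Rabs_pos_eq a) by lra.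
  apply Rmult_le_compat_r; [apply Rabs_pos|lra]. }
specialize (U Huw).
(* [u ^ 2 = (h / a) ^ 2 * w ^ 2], and [w ^ 2] and [exp u + exp (- u)] are each
   a multiple of [s] at most, so [s ^ 2] dominates the remainder. *)
assert (W := sqr_le_exp_sum w).
set (s := exp w + exp (- w)) in *.
assert (Hs : 0 < s) by (apply Rplus_lt_0_compat; apply exp_pos).
replace (exp w * exp w * k + 2 * k + exp (- w) * exp (- w) * k) with (s * s * k).
2: { transitivity ((exp w * exp w + 2 * (exp w * exp (- w)) + exp (- w) * exp (- w)) * k).
     - unfold s; ring.
     - rewrite E; ring. }
replace (h ^ 2 * (8 / a ^ 2 * (s * s * k)))
  with ((h ^ 2 * / a ^ 2 * (4 * s) * (2 * s)) * k) by (field; lra).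
apply Rmult_le_compat_r; [lra|].
apply Rle_trans with (u ^ 2 * (exp u + exp (- u))); [lra|].
apply Rmult_le_compat.
- apply pow2_ge_0.
- apply Rlt_le, Rplus_lt_0_compat; apply exp_pos.
- replace (u ^ 2) with (h ^ 2 * / a ^ 2 * w ^ 2) by (unfold u, w; field; lra).
  rewrite !Rmult_assoc. apply Rmult_le_compat_l; [apply pow2_ge_0|].
  apply Rmult_le_compat_l; [|lra].
  apply Rlt_le, Rinv_0_lt_compat; nra.
- exact U.
Qed.

(** Jensen's inequality for the probability density [exp (- t)]: if [m] is the
    mean of [ln t], integrating the tangent bound
    [t ^ x >= exp (x m) (1 + x ln t - x m)] gives [Gamma (x + 1) >= exp (x m)]. *)
Lemma Gamma_pos x : 0 < x -> 0 < Gamma x.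
Proof.
intros Hx.
assert (G1 : is_half_line_integral (euler_kernel 1) 1).
{ apply half_line_ext with (fun t => exp (- t)).
  { intros t Ht; rewrite euler_kernel_exp; f_equal; ring. }
  replace 1 with (0 - (- 1)) by ring.
  apply half_line_antiderivative with (fun t => - exp (- t)).
  - intros t Ht; auto_derive; auto; ring.
  - intros t Ht; apply continuous_of_derive.
    auto_derive; auto.
  - replace (- 1) with (- exp (- 0)) by (rewrite Ropp_0, exp_0; ring).
    apply (continuous_at_right_0 (fun t => - exp (- t))), continuous_of_derive.
    auto_derive; auto.
  - replace (Finite 0) with (Rbar_opp 0) by (simpl; f_equal; ring).
    apply is_lim_opp, (is_lim_comp exp Ropp p_infty 0 m_infty).
    + apply is_lim_exp_m.
    + apply (is_lim_opp (fun t => t) p_infty p_infty), is_lim_id.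
    + exists 0; discriminate. }
destruct (Gamma_derivative_integral 1 Rlt_0_1) as [m Hm].
assert (J : exp (x * m) * (1 - x * m) * 1 + exp (x * m) * x * m <= Gamma (x + 1)).
{ refine (half_line_le _ _ _ _ _
    (half_line_plus _ _ _ _ (half_line_scal _ (exp (x * m) * (1 - x * m)) _ G1)
       (half_line_scal _ (exp (x * m) * x) _ Hm))
    (Gamma_integral (x + 1) ltac:(lra))).
  intros t Ht.
  replace (x + 1) with (1 + x) by ring; rewrite euler_kernel_shift.
  rewrite <- Rmult_assoc, <- Rmult_plus_distr_r.
  apply Rmult_le_compat_r; [apply Rlt_le, euler_kernel_pos|].
  replace (x * ln t) with (x * m + (x * ln t - x * m)) by ring.
  rewrite exp_plus.
  assert (A := exp_ineq1_le (x * ln t - x * m)).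
  assert (B := exp_pos (x * m)). nra. }
rewrite Gamma_succ in J by auto.
assert (B := exp_pos (x * m)).
assert (0 < x * Gamma x) by lra. nra.
Qed.

(** * The digamma function *)

Lemma psi_succ x : 0 < x -> psi (x + 1) = psi x + / x.
Proof.
intros Hx.
destruct (Gamma_derivative_integral x Hx) as [l Hl].
destruct (Gamma_derivative_integral (x + 1) ltac:(lra)) as [l' Hl'].
assert (D := Gamma_derive x l Hx Hl).
assert (D' := Gamma_derive (x + 1) l' ltac:(lra) Hl').
assert (E : l' = Gamma x + x * l).
{ assert (D1 := is_derive_shift _ _ _ D').
  assert (D2 : is_derive (fun y => y * Gamma y) x (1 * Gamma x + x * l)).
  { apply (is_derive_mult (fun y => y) Gamma x 1 l); auto.
    - apply (@is_derive_id R_AbsRing).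
    - intros; apply Rmult_comm. }
  assert (D3 : is_derive (fun y => y * Gamma y) x l').
  { apply is_derive_ext_loc with (2 := D1).
    exists (mkposreal x Hx); intros y Hy.
    apply ball_R in Hy; simpl in Hy; apply Gamma_succ; lra. }
  rewrite <- (is_derive_unique _ _ _ D3), (is_derive_unique _ _ _ D2); ring. }
unfold psi; rewrite (is_derive_unique _ _ _ D), (is_derive_unique _ _ _ D').
rewrite Gamma_succ, E by auto.
assert (P := Gamma_pos x Hx). field; lra.
Qed.

(** Under the density proportional to [t ^ (x - 1) exp (- t)], [psi x] is the mean
    of [ln t] and [x] is the mean of [t]; the tangent of [ln] at [x] lies
    above it. *)
Lemma psi_le_ln x : 0 < x -> psi x <= ln x.
Proof.
intros Hx.
destruct (Gamma_derivative_integral x Hx) as [l Hl].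
unfold psi; rewrite (is_derive_unique _ _ _ (Gamma_derive x l Hx Hl)).
assert (P := Gamma_pos x Hx).
assert (J : l <= (ln x - 1) * Gamma x + / x * Gamma (x + 1)).
{ refine (half_line_le _ _ _ _ _ Hl (half_line_plus _ _ _ _
    (half_line_scal _ (ln x - 1) _ (Gamma_integral x Hx))
    (half_line_scal _ (/ x) _ (Gamma_integral (x + 1) ltac:(lra))))).
  intros t Ht; rewrite euler_kernel_shift, Rmult_1_l, exp_ln by auto.
  rewrite <- Rmult_assoc, <- Rmult_plus_distr_r.
  apply Rmult_le_compat_r; [apply Rlt_le, euler_kernel_pos|].
  assert (A := ln_le_tangent x t Hx Ht). unfold Rdiv in A; lra. }
rewrite Gamma_succ in J by auto.
replace (/ x * (x * Gamma x)) with (Gamma x) in J by (field; lra).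
apply Rmult_le_reg_r with (Gamma x); auto.
unfold Rdiv; rewrite Rmult_assoc, Rinv_l by lra. lra.
Qed.

(** By [psi_succ] the claim is [ln x <= psi (x + 1)].  Use the tangent bound
    [ln t >= ln x + 1 - x / t]: the mean of [x / t] under the density of
    parameter [x + 1] is [x Gamma x / Gamma (x + 1) = 1]. *)
Lemma ln_le_psi x : 0 < x -> ln x - / x <= psi x.
Proof.
intros Hx.
rewrite <- (Rplus_0_r (psi x)), <- (Rplus_opp_r (/ x)), <- Rplus_assoc.
rewrite <- psi_succ by auto.
assert (Hy : 0 < x + 1) by lra.
destruct (Gamma_derivative_integral (x + 1) Hy) as [l Hl].
unfold psi; rewrite (is_derive_unique _ _ _ (Gamma_derive (x + 1) l Hy Hl)).
assert (P := Gamma_pos (x + 1) Hy).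
assert (J : (ln x + 1) * Gamma (x + 1) - x * Gamma x <= l).
{ refine (half_line_le _ _ _ _ _ (half_line_minus _ _ _ _
    (half_line_scal _ (ln x + 1) _ (Gamma_integral (x + 1) Hy))
    (half_line_scal _ x _ (Gamma_integral x Hx))) Hl).
  intros t Ht; rewrite euler_kernel_shift, Rmult_1_l, exp_ln by auto.
  rewrite <- !Rmult_assoc, <- Rmult_minus_distr_r.
  apply Rmult_le_compat_r; [apply Rlt_le, euler_kernel_pos|].
  assert (A := ln_le_tangent t x Ht Hx).
  apply Rmult_le_compat_l with (r := t) in A; [|lra].
  replace (t * (ln t + x / t - 1)) with (t * ln t + x - t) in A by (field; lra).
  lra. }
rewrite <- Gamma_succ in J by auto.
assert (ln x <= l / Gamma (x + 1)); [|lra].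
apply Rmult_le_reg_r with (Gamma (x + 1)); auto.
unfold Rdiv; rewrite Rmult_assoc, Rinv_l by lra. lra.
Qed.

(** [psi (n + 1)] is [psi 1] plus a harmonic number, and [psi n - ln n] tends
    to [0]. *)
Lemma psi_one : psi 1 = - Euler_gamma.
Proof.
assert (H : forall n, psi (INR (S n) + 1) = psi 1 + sum_n (fun k => / INR (S k)) n).
{ induction n as [|n IH].
  - rewrite sum_O; simpl INR; rewrite psi_succ by lra; reflexivity.
  - rewrite sum_Sn, psi_succ by apply lt_0_INR, Nat.lt_0_succ.
    rewrite (S_INR (S n)) at 1. rewrite IH.
    change (psi 1 + sum_n (fun k => / INR (S k)) n + / INR (S (S n)) =
      psi 1 + (sum_n (fun k => / INR (S k)) n + / INR (S (S n)))). ring. }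
assert (L : is_lim_seq (fun n => sum_n (fun k => / INR (S k)) n - ln (INR (S n)))
              (- psi 1)).
{ apply is_lim_seq_le_le with (fun n => - psi 1) (fun n => - psi 1 + / INR (S n)).
  - intros n. assert (P : 0 < INR (S n)) by apply lt_0_INR, Nat.lt_0_succ.
    assert (A := psi_le_ln _ P). assert (B := ln_le_psi _ P).
    specialize (H n); rewrite psi_succ in H by auto.
    lra.
  - apply is_lim_seq_const.
  - replace (- psi 1) with (- psi 1 + 0) at 1 by ring.
    apply is_lim_seq_plus'; [apply is_lim_seq_const|].
    evar_last.
    + apply is_lim_seq_inv with (l := p_infty); [|discriminate].
      apply -> (is_lim_seq_incr_1 INR p_infty); apply is_lim_seq_INR.
    + reflexivity. }
unfold Euler_gamma; rewrite (is_lim_seq_unique _ _ L); simpl; ring.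
Qed.

(** * Monotonicity, concavity and limits of phi *)

Lemma phi_step x : 0 < x -> phi x = log_gap x + phi (x + 1).
Proof.
intros Hx; unfold phi, log_gap; rewrite psi_succ by auto.
unfold log_term; ring.
Qed.

Lemma phi_bounds x : 0 < x -> - / x <= phi x <= / x.
Proof.
intros Hx.
assert (A := psi_le_ln x Hx). assert (B := ln_le_psi x Hx).
assert (C := log_term_bounds x Hx). unfold log_term in C; unfold phi; lra.
Qed.

Lemma phi_lim_infty : is_lim phi p_infty 0.
Proof.
apply is_lim_le_le_loc with (fun x => - / x) Rinv.
- exists 0; intros x Hx; apply phi_bounds, Hx.
- replace (Finite 0) with (Rbar_opp 0) by (simpl; f_equal; ring).
  apply is_lim_opp, is_lim_inv_p_infty.
- apply is_lim_inv_p_infty.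
Qed.

Lemma phi_lim_shift x : is_lim_seq (fun n => phi (x + INR n)) 0.
Proof.
apply (is_lim_comp_seq phi (fun n => x + INR n) p_infty 0).
- apply phi_lim_infty.
- exists 0%nat; intros; discriminate.
- apply is_lim_seq_plus with (Finite x) p_infty.
  + apply is_lim_seq_const.
  + apply is_lim_seq_INR.
  + reflexivity.
Qed.

Lemma phi_concave : strictly_concave_on (fun x => 0 < x) phi.
Proof.
apply strictly_concave_of_telescoping with log_gap.
- exact log_gap_concave.
- exact phi_step.
- exact phi_lim_shift.
Qed.

Lemma phi_increasing : strictly_increasing_on (fun x => 0 < x) phi.
Proof.
exact (strictly_increasing_of_concave_limit phi 0 phi_concave phi_lim_infty).
Qed.

(** In [phi x = ln (1 - exp (- / x)) - log_term (x + 1) + phi (x + 1)] the first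
    term vanishes in the limit, and the other two tend to
    [- log_term 1 + phi 1 = psi 1], because a concave function is continuous. *)
Lemma phi_lim_0 : filterlim phi (at_right 0) (locally (- Euler_gamma)).
Proof.
(* Squeeze to the right of [1]: [phi] lies above [phi 1] by monotonicity, and
   below the line through the points at [1 / 2] and [1] by concavity. *)
assert (R1 : filterlim (fun h => phi (h + 1)) (at_right 0) (locally (phi 1))).
{ set (s := 2 * (phi 1 - phi (1 / 2))).
  apply squeeze_at_right_0 with (fun _ => phi 1) (fun h => phi 1 + h * s).
  - intros h Hh; split.
    + apply Rlt_le, phi_increasing; lra.
    + set (t := h / (h + 1 / 2)).
      assert (Et : t * (h + 1 / 2) = h) by (unfold t; field; lra).
      assert (Ht : 0 < t < 1) by (split; nra).
      assert (C := phi_concave (1 / 2) (h + 1) t ltac:(lra) ltac:(lra) ltac:(lra) Ht).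
      replace (t * (1 / 2) + (1 - t) * (h + 1)) with 1 in C by lra.
      assert (C' := Rmult_lt_compat_r (h + 1 / 2) _ _ ltac:(lra) C).
      replace ((t * phi (1 / 2) + (1 - t) * phi (h + 1)) * (h + 1 / 2)) with
        ((t * (h + 1 / 2)) * phi (1 / 2)
         + (h + 1 / 2 - t * (h + 1 / 2)) * phi (h + 1)) in C' by ring.
      rewrite Et in C'. unfold s; lra.
  - apply filterlim_const.
  - replace (locally (phi 1)) with (locally (phi 1 + 0 * s)) by (f_equal; ring).
    apply (continuous_at_right_0 (fun h => phi 1 + h * s)), continuous_of_derive.
    auto_derive; auto. }
assert (R2 : filterlim (fun x => ln (1 - exp (- / x))) (at_right 0) (locally 0)).
{ apply (filterlim_comp _ _ _ (fun x => exp (- / x)) (fun y => ln (1 - y)) _ (locally 0)).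
  - apply squeeze_at_right_0 with (fun _ => 0) (fun x => x).
    + intros x Hx.
      split; [apply Rlt_le, exp_pos|].
      assert (A := exp_ineq1_le (/ x)). assert (I := Rinv_0_lt_compat x Hx).
      rewrite exp_Ropp. rewrite <- (Rinv_inv x) at 2.
      apply Rinv_le_contravar; lra.
    + apply filterlim_const.
    + apply (continuous_at_right_0 (fun x => x)), continuous_id.
  - replace (locally 0) with (locally (ln (1 - 0))) at 2
      by (rewrite Rminus_0_r, ln_1; reflexivity).
    apply (continuous_of_derive (fun y => ln (1 - y))).
    auto_derive; lra. }
assert (R3 : filterlim (fun x => log_term (x + 1)) (at_right 0) (locally (log_term 1))).
{ replace (log_term 1) with (log_term (0 + 1)) by (f_equal; ring).
  apply (continuous_at_right_0 (fun x => log_term (x + 1))), continuous_of_derive.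
  eexists; apply is_derive_shift, log_term_derive; lra. }
replace (- Euler_gamma) with ((0 + - log_term 1) + phi 1)
  by (unfold phi; rewrite psi_one; unfold log_term; ring).
apply filterlim_ext_loc with
  (fun x => (ln (1 - exp (- / x)) + - log_term (x + 1)) + phi (x + 1)).
{ apply at_right_0_pos; intros x Hx.
  rewrite (phi_step x Hx); f_equal; unfold log_gap, Rminus at 2; f_equal.
  assert (I := Rinv_0_lt_compat x Hx). assert (E := exp_gt_1 _ I).
  unfold log_term; replace (1 / x) with (/ x) by (field; lra).
  rewrite <- (ln_exp (/ x)) at 3; rewrite <- ln_div by lra.
  f_equal; rewrite exp_Ropp; field; lra. }
assert (add : forall (f g : R -> R) (lf lg : R),
  filterlim f (at_right 0) (locally lf) -> filterlim g (at_right 0) (locally lg) ->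
  filterlim (fun x => f x + g x) (at_right 0) (locally (lf + lg))).
{ intros f g lf lg Hf Hg.
  exact (filterlim_comp_2 _ _ _ Hf Hg (@filterlim_plus R_AbsRing R_NormedModule lf lg)). }
apply add; [apply add|]; [exact R2| |exact R1].
apply (filterlim_comp _ _ _ _ Ropp _ _ _ R3).
apply (@filterlim_opp R_AbsRing R_NormedModule).
Qed.

Theorem theorem1 :
  strictly_increasing_on (fun x : R => 0 < x) phi /\
  strictly_concave_on (fun x : R => 0 < x) phi /\
  filterlim phi (at_right 0) (locally (- Euler_gamma)) /\
  is_lim phi p_infty 0.
Proof.
split; [exact phi_increasing|].
split; [exact phi_concave|].
split; [exact phi_lim_0|exact phi_lim_infty].
Qed.
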